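(* Let $r\ge 2$, $d\ge 1$ be integers, $n=(r-1)(d+1)+1$, and let $A=\{a_1,\ldots,a_n\}\subset\mathbb{R}^d$ be a set of $n$ points whose $dn$ coordinates are algebraically independent (over $\mathbb{Q}$). Let $k\in\{0,1,\ldots,r-1\}$. Then there is a proper partition $\{A_1,\ldots,A_r\}$ of $A$ such that in the unique solution $(z,\alpha)$ of the system \[ z=\sum_{x\in A_j}\alpha(x)\,x \quad\text{and}\quad 1=\sum_{x\in A_j}\alpha(x)\qquad\text{for all } j\in[r], \] (unknowns $z\in\mathbb{R}^d$ and $\alpha(x)\in\mathbb{R}$ for $x\in A$) one has $\alpha(x)<0$ for exactly $k$ elements $x\in A$.
   Context: $[r]=\{1,\ldots,r\}$. A partition $\{A_1,\ldots,A_r\}$ of $A$ into $r$ parts is called proper if $1\le |A_j|\le d+1$ for every $j\in[r]$. For a proper partition and $A$ as in the claim, $\bigcap_{j=1}^r \operatorname{aff} A_j$ is a single point, equivalently the displayed linear system has a unique solution. The case $k=0$ is Tverberg's theorem. *)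

(* Defs.v *)
From HB Require Import structures.
From mathcomp Require Import all_boot all_order all_algebra.
Set Implicit Arguments. Unset Strict Implicit. Unset Printing Implicit Defensive.
Import Order.TTheory GRing.Theory Num.Theory.
Local Open Scope ring_scope.

(* Algebraic independence over Q of a finite family x : I -> R.
   A polynomial with rational coefficients in the variables X_i (i : I), of
   degree < D in each variable, is given by its coefficient function
   p : {ffun {ffun I -> 'I_D} -> rat} (exponent vector e |-> coefficient).
   Every rational polynomial arises this way for D large enough. *)
Definition alg_indep_Q (R : unitRingType) (I : finType) (x : I -> R) : Prop :=
  forall (D : nat) (p : {ffun {ffun I -> 'I_D} -> rat}), p != 0 ->
    \sum_(e : {ffun I -> 'I_D}) ratr (p e) * \prod_(i : I) x i ^+ e i != 0.

Definition proper_partition (n d r : nat) (P : {set {set 'I_n}}) : bool :=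
  [&& partition P [set: 'I_n], #|P| == r & [forall B in P, (1 <= #|B| <= d.+1)%N]].

Definition tverberg_system (R : pzRingType) (n d : nat) (a : 'I_n -> 'rV[R]_d)
  (P : {set {set 'I_n}}) (z : 'rV[R]_d) (alpha : 'I_n -> R) : Prop :=
  forall B, B \in P ->
    z = \sum_(x in B) alpha x *: a x /\ \sum_(x in B) alpha x = 1.

(* Main.v *)
Require Import Defs.
From HB Require Import structures.
From mathcomp Require Import all_boot all_order all_algebra ring lra zify.
From mathcomp Require Import mpoly.
Import Order.TTheory GRing.Theory Num.Theory.
Local Open Scope ring_scope.

(** Sarkaria's tensor trick with signs.  Let u_i = (1, a_i) and let K be the k points
    with the smallest first coordinate.  The colorful Caratheodory theorem in dimension
    (r - 1)(d + 1), applied to the classes { +- u_i (x) w_j : j } with sign - exactly for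
    i in K, yields a colouring of the points and weights l_i >= 0, not all zero, such that
    the signed sums of the l_i u_i over the r colour classes all equal one vector v.  A
    hyperplane separates K from the other points, so v <> 0; and as k < r, some
    colour class avoids K, so the leading coordinate of v is positive.  A solution of
    minimal support has at most d + 1 points of each colour, and algebraic independence
    then forces full support.  Dividing by the leading coordinate of v gives
    coefficients that are negative exactly on K. *)

Set Implicit Arguments.
Unset Strict Implicit.
Unset Printing Implicit Defensive.

(** * Points of minimal norm in a simplex *)

Section Dot.
Variables (R : realFieldType) (N : nat).
Implicit Types u v w : 'rV[R]_N.

Definition dot u v : R := \sum_j u 0 j * v 0 j.

Lemma dotE u v : dot u v = (u *m v^T) 0 0.
Proof. by rewrite mxE; apply: eq_bigr => j _; rewrite mxE. Qed.

Lemma dotC u v : dot u v = dot v u.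
Proof. by apply: eq_bigr => j _; rewrite mulrC. Qed.

Lemma dotDr u v w : dot u (v + w) = dot u v + dot u w.
Proof. by rewrite -big_split; apply: eq_bigr => j _; rewrite mxE mulrDr. Qed.

Lemma dotDl u v w : dot (v + w) u = dot v u + dot w u.
Proof. by rewrite dotC dotDr !(dotC u). Qed.

Lemma dotZr c u v : dot u (c *: v) = c * dot u v.
Proof. by rewrite mulr_sumr; apply: eq_bigr => j _; rewrite mxE mulrCA. Qed.

Lemma dotZl c u v : dot (c *: v) u = c * dot v u.
Proof. by rewrite dotC dotZr dotC. Qed.

Lemma dot0r u : dot u 0 = 0.
Proof. by rewrite -(scale0r 0) dotZr mul0r. Qed.

Lemma dotNr u v : dot u (- v) = - dot u v.
Proof. by rewrite -scaleN1r dotZr mulN1r. Qed.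

Lemma dot_sumr (I : finType) (P : pred I) (F : I -> 'rV[R]_N) u :
  dot u (\sum_(i | P i) F i) = \sum_(i | P i) dot u (F i).
Proof. by apply: (big_morph (dot u)) => [v w|]; rewrite ?dotDr ?dot0r. Qed.

Lemma dot_ge0 u : 0 <= dot u u.
Proof. by apply: sumr_ge0 => j _; rewrite -expr2 sqr_ge0. Qed.

Lemma dot_eq0 u : (dot u u == 0) = (u == 0).
Proof.
rewrite psumr_eq0 => [|j _]; last by rewrite -expr2 sqr_ge0.
apply/allP/eqP => [h|-> j _]; last by rewrite /= mxE mulr0 eqxx.
apply/rowP => j; rewrite mxE; apply/eqP.
by have := h j (mem_index_enum _); rewrite /= mulf_eq0 orbb.
Qed.

Lemma dot_gt0 u : (0 < dot u u) = (u != 0).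
Proof. by rewrite lt0r dot_eq0 dot_ge0 andbT. Qed.

(** The squared norm drops by t(|u|^2 - |v|^2) + t(1 - t)|v - u|^2, a sum of non-negative terms. *)
Lemma dot_convex u v (t : R) : 0 <= t <= 1 -> dot v v <= dot u u ->
  dot (u + t *: (v - u)) (u + t *: (v - u)) <= dot u u.
Proof.
move=> /andP[t0 t1] le_vu; have := mulr_ge0 (mulr_ge0 t0 _) (dot_ge0 (v - u)).
move=> /(_ (1 - t)); rewrite subr_ge0 => /(_ t1).
have := mulr_ge0 t0 (_ : 0 <= dot u u - dot v v); rewrite subr_ge0 => /(_ le_vu).
rewrite -(scaleN1r u) !(dotDl, dotDr, dotZl, dotZr) (dotC v u).
by move: (dot v v) (dot u u) (dot u v) => a b c; lra.
Qed.

Lemma dot_mulmxr m (A : 'M[R]_(m, N)) u (y : 'rV_m) :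
  u *m A^T = 0 -> dot u (y *m A) = 0.
Proof. by move=> uA; rewrite dotE trmx_mul mulmxA uA mul0mx mxE. Qed.

End Dot.

Lemma mxrank_gram (R : realFieldType) m N (A : 'M[R]_(m, N)) :
  \rank (A *m A^T) = \rank A.
Proof.
rewrite -(mxrank_mul_ker A A^T) (_ : (A :&: _)%MS = 0) ?mxrank0 ?addn0 //.
apply/eqP/rowV0P => v; rewrite sub_capmx => /andP[/submxP[y ->] /sub_kermxP vA].
by apply/eqP; rewrite -dot_eq0 (dot_mulmxr _ vA).
Qed.

(** The normal equations are solvable because [A *m A^T] has the same row space as [A^T]; Pythagoras
    then gives minimality. *)
Lemma least_squares (R : realFieldType) m N (A : 'M[R]_(m, N)) (b : 'rV_N) :
  exists y : 'rV_m, forall y' : 'rV_m,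
    dot (b + y *m A) (b + y *m A) <= dot (b + y' *m A) (b + y' *m A).
Proof.
have /submxP[D bD] : (b *m A^T <= A *m A^T)%MS.
  have [_ /esym] := mxrank_leqif_eq (submxMl A A^T).
  by rewrite mxrank_gram mxrank_tr eqxx => /eqmxP->; apply: submxMl.
exists (- D) => y'; set p := b + - D *m A.
have pA : p *m A^T = 0 by rewrite /p mulNmx mulmxBl -mulmxA bD subrr.
have -> : b + y' *m A = p + (y' + D) *m A.
  by rewrite /p mulmxDl mulNmx addrACA addNr addr0.
clearbody p; rewrite dotDl !dotDr (dotC (_ *m A)) !(dot_mulmxr _ pA) addr0 add0r lerDl.
exact: dot_ge0.
Qed.

(** The ratio test of linear programming: t is the smallest quotient l_i / (- m_i) over the indices
    with m_i < 0. *)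
Lemma boundary_step (R : realFieldType) (I : finType) (l m : I -> R) :
  (forall i, 0 <= l i) -> (exists i, m i < 0) ->
  exists t : R, [/\ 0 <= t, forall i, 0 <= l i + t * m i
                  & exists2 i, m i < 0 & l i + t * m i = 0].
Proof.
move=> l0 [i0 mi0]; case: (@arg_minP _ _ _ i0 (fun i => m i < 0)
   (fun i => l i / - m i) mi0) => i mi tmin.
exists (l i / - m i); split.
- by apply: divr_ge0 => //; rewrite oppr_ge0 ltW.
- move=> j; have [mj|mj] := ltP (m j) 0.
    by have := tmin j mj; rewrite ler_pdivlMr ?oppr_gt0 // mulrN lerNl; lra.
  by rewrite addr_ge0 // mulr_ge0 // divr_ge0 // oppr_ge0 ltW.
- by exists i => //; rewrite invrN mulrN mulNr mulfVK ?lt_eqF // subrr.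
Qed.

Definition simplex (R : realFieldType) m (S : {set 'I_m}) (l : 'rV[R]_m) : Prop :=
  [/\ forall i, 0 <= l 0 i, forall i, i \notin S -> l 0 i = 0 & \sum_i l 0 i = 1].

Lemma simplex_neq0 (R : realFieldType) m (S : {set 'I_m}) (l : 'rV[R]_m) :
  simplex S l -> S != set0.
Proof.
case=> _ lS l1; apply/eqP => S0; move: l1; rewrite big1 => [/eqP|i _].
  by rewrite eq_sym oner_eq0.
by rewrite lS // S0 inE.
Qed.

(** The premise on [S] comes after the existential so that one choice function covers all sets, with
    0 as a dummy for the empty one. *)
Lemma affine_min (R : realFieldType) m N (W : 'M[R]_(m, N)) (S : {set 'I_m}) :
  exists l : 'rV[R]_m, S != set0 ->
  [/\ forall i, i \notin S -> l 0 i = 0, \sum_i l 0 i = 1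
    & forall q : 'rV[R]_m, (forall i, i \notin S -> q 0 i = 0) ->
      \sum_i q 0 i = 1 -> dot (l *m W) (l *m W) <= dot (q *m W) (q *m W)].
Proof.
have [->|/set0Pn[i0 i0S]] := eqVneq S set0; first by exists 0.
(* Row i of [E] is the edge vector from i0 to i if i is in [S] and 0 otherwise, so [e + y *m E] runs
   through the affine combinations supported in [S]. *)
pose E : 'M[R]_m := \matrix_(i, j) ((i \in S)%:R * ((i == j)%:R - (j == i0)%:R)).
pose e : 'rV[R]_m := delta_mx 0 i0.
have EE i j : E i j = (i \in S)%:R * ((i == j)%:R - (j == i0)%:R) by rewrite mxE.
have eE i : e 0 i = (i == i0)%:R by rewrite mxE eqxx.
have yE (y : 'rV[R]_m) j : (y *m E) 0 j
    = (j \in S)%:R * y 0 j - (j == i0)%:R * \sum_(i in S) y 0 i.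
  rewrite mxE [in RHS]big_mkcond mulr_sumr /=.
  rewrite (bigD1 j) //= [in RHS](bigD1 j) //= EE eqxx opprD addrA; congr (_ + _).
    by case: (j \in S); rewrite !(mul0r, mul1r, mulr0, subr0) // mulrBr mulr1 mulrC.
  rewrite -sumrN; apply: eq_bigr => i /negPf nij; rewrite EE nij sub0r.
  by case: (i \in S); rewrite !(mul0r, mul1r, mulr0, oppr0) // mulrN mulrC.
have [y ymin] := least_squares (E *m W) (e *m W).
exists (e + y *m E) => _; split.
- move=> i iS; rewrite mxE yE (negPf iS) eE.
  by case: eqP iS => [->|_ _]; rewrite ?i0S // !mul0r subr0 addr0.
- under eq_bigr do rewrite mxE yE eE.
  rewrite big_split /= (bigD1 i0) //= big1 ?addr0; last first.
    by move=> i /negPf ->.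
  rewrite eqxx sumrB -mulr_suml.
  have -> : \sum_i (i == i0)%:R = 1 :> R.
    by rewrite (bigD1 i0) //= eqxx big1 ?addr0 // => i /negPf ->.
  rewrite mul1r (_ : \sum_i _ = \sum_(i in S) y 0 i) ?subrr ?addr0 //.
  by rewrite [RHS]big_mkcond; apply: eq_bigr => i _; case: ifP => _; rewrite ?mul1r ?mul0r.
- move=> q qS q1; have -> : q = e + q *m E.
    apply/rowP => j; rewrite mxE yE eE.
    have -> : \sum_(i in S) q 0 i = 1.
      rewrite -q1 [RHS](bigID (mem S)) /= [X in _ + X]big1 ?addr0 //.
    rewrite mulr1 addrCA subrr addr0; case: (boolP (j \in S)) => jS.
      by rewrite mul1r.
    by rewrite mul0r qS.
  rewrite !mulmxDl -!mulmxA; exact: ymin.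
Qed.

(** An ordered field offers no compactness, so the minimum is taken over the finitely many faces
    whose affine minimiser has non-negative weights. They suffice: if the minimiser for the face of
    q has a negative weight, moving q towards it until a weight vanishes does not increase the norm
    and reaches a smaller face. *)
Lemma simplex_min (R : realFieldType) m N (W : 'M[R]_(m.+1, N)) :
  exists l : 'rV[R]_m.+1, simplex setT l /\
    forall q, simplex setT q -> dot (l *m W) (l *m W) <= dot (q *m W) (q *m W).
Proof.
have [g gP] := fin_all_exists (affine_min W).
pose f (q : 'rV[R]_m.+1) := dot (q *m W) (q *m W).
pose good S := (S != set0) && [forall i, 0 <= g S 0 i].
have reach k (S : {set 'I_m.+1}) (q : 'rV[R]_m.+1) :
    (#|S| <= k)%N -> simplex S q -> exists2 S', good S' & f (g S') <= f q.
  elim: k S q => [|k IHk] S q leSk Sq; have S0 := simplex_neq0 Sq.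
    by move: leSk; rewrite leqn0 cards_eq0 (negPf S0).
  have [q0 qS q1] := Sq.
  have [lS l1 lmin] := gP S S0.
  have [/forallP l0|/forallPn[i]] := boolP [forall i, 0 <= g S 0 i].
    by exists S; [rewrite /good S0; apply/forallP|apply: lmin].
  rewrite -ltNge => li.
  have [||t [t0 qt0 [j lj jt]]] := @boundary_step _ _ (q 0) (fun i => (g S - q) 0 i).
  - exact: q0.
  - by exists i; rewrite !mxE; have := q0 i; lra.
  pose q' := q + t *: (g S - q).
  have q'E i' : q' 0 i' = q 0 i' + t * (g S - q) 0 i' by rewrite !mxE.
  (* Weight i of [g S] is negative, so t > 1 would make weight i of the moved point negative too. *)
  have t1 : t <= 1.
    have := qt0 i; have := q0 i; rewrite !mxE; move: (q 0 i) (g S 0 i) li => a b.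
    by move=> b0 a0 h; rewrite leNgt; apply/negP => t1; nra.
  have jS : j \in S.
    by apply: contraLR lj => jS; rewrite !mxE lS // qS // subr0 ltxx.
  have [||S' gS' leS'] := IHk (S :\ j) q'.
  - by move: leSk; rewrite (cardsD1 j) jS.
  - split=> [i'|i'|]; first by rewrite q'E.
      rewrite !inE negb_and negbK q'E => /orP[/eqP->//|i'S].
      by rewrite !mxE lS // qS // subr0 mulr0 addr0.
    under eq_bigr do rewrite q'E !mxE.
    by rewrite big_split /= -mulr_sumr sumrB l1 q1 subrr mulr0 addr0.
  exists S' => //; apply: le_trans leS' _; rewrite /f mulmxDl -scalemxAl mulmxBl.
  by apply: dot_convex; rewrite ?t0 //; apply: lmin.
have [S0 gS0 _] : exists2 S, good S & f (g S) <= f (delta_mx 0 0).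
  apply: (reach m.+1 setT); first by rewrite cardsT card_ord.
  split=> [i|i|]; first by rewrite mxE; apply: ler0n.
    by rewrite inE.
  rewrite (bigD1 0) //= mxE !eqxx big1 ?addr0 // => i /negPf ni.
  by rewrite mxE ni andbF.
case: (@arg_minP _ _ _ S0 good (fun S => f (g S)) gS0) => S /andP[nS0 /forallP gS] Smin.
have [lS l1 _] := gP S nS0.
exists (g S); split; first by split=> // i; rewrite inE.
move=> q Dq; have [|S' gS' le'] := reach m.+1 setT q _ Dq.
  by rewrite cardsT card_ord.
exact: le_trans (Smin _ gS') le'.
Qed.

(** * The colorful Caratheodory theorem *)

(** Induction on the size of the support: a kernel vector supported there and not proportional to l
    is added to l, up to sign, until an entry vanishes. *)
Lemma minimal_kernel_vector (R : realFieldType) m N (M : 'M[R]_(m, N)) (l : 'rV_m) :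
  (forall i, 0 <= l 0 i) -> l != 0 -> l *m M = 0 ->
  exists l' : 'rV_m, [/\ forall i, 0 <= l' 0 i, l' != 0, l' *m M = 0
    & forall u : 'rV_m, u *m M = 0 -> (forall i, l' 0 i = 0 -> u 0 i = 0) ->
        exists a, u = a *: l'].
Proof.
have [k] := ubnP #|[set i | l 0 i != 0]|; elim: k l => // k IHk l ltk l0 nzl lM.
pose D : 'M[R]_m := diag_mx (\row_i (l 0 i == 0)%:R).
have uD (u : 'rV_m) : u *m D = 0 <-> forall i, l 0 i = 0 -> u 0 i = 0.
  split=> [/rowP uD i li|ul].
    by have := uD i; rewrite mul_mx_diag !mxE li eqxx mulr1.
  apply/rowP => i; rewrite mul_mx_diag !mxE.
  by case: eqP => [/ul->|_]; rewrite ?mul0r ?mulr0.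
have [Kl|/row_subPn[i0 uNl]] := boolP (kermx (row_mx M D) <= l)%MS.
  exists l; split=> // u uM ul; apply/sub_rVP; apply: submx_trans Kl.
  by apply/sub_kermxP; rewrite mul_mx_row uM (proj2 (uD u) ul) row_mx0.
have [u [uM ul uNl' [i ui]]] : exists u : 'rV_m, [/\ u *m M = 0,
    forall i, l 0 i = 0 -> u 0 i = 0, ~~ (u <= l)%MS & exists i, u 0 i < 0].
  move: uNl (row_sub i0 (kermx (row_mx M D))); move: (row i0 _) => u uNl /sub_kermxP.
  rewrite mul_mx_row -row_mx0 => /eq_row_mx[uM /uD ul].
  have [/existsP ui|u_ge0] := boolP [exists i, u 0 i < 0].
    by exists u; split.
  exists (- u); split.
  - by rewrite mulNmx uM oppr0.
  - by move=> i /ul; rewrite mxE => ->; rewrite oppr0.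
  - by rewrite eqmx_opp.
  - move: u_ge0 => /existsPn u_ge0.
    have /rV0Pn[i ui] : u != 0 by apply: contraNneq uNl => ->; rewrite sub0mx.
    by exists i; rewrite mxE oppr_lt0 lt0r ui leNgt u_ge0.
have [||t [t0 lt0 [j uj ljt]]] := @boundary_step _ _ (l 0) (u 0) => //.
  by exists i.
have l'E i' : (l + t *: u) 0 i' = l 0 i' + t * u 0 i' by rewrite !mxE.
apply: (IHk (l + t *: u)).
- apply: leq_trans (ltnSE ltk); apply: proper_card; apply/properP; split.
    apply/subsetP => i'; rewrite !inE l'E; apply: contra_neq => li.
    by rewrite li ul // mulr0 addr0.
  exists j; rewrite !inE ?l'E ?ljt ?eqxx //.
  by apply: contraTneq uj => /ul ->; rewrite ltxx.
- by move=> i'; rewrite l'E.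
(* A zero sum would make u a multiple of l, or l itself zero if t = 0. *)
- apply/eqP => l'0; have [t00|nzt] := eqVneq t 0.
    by move: l'0 nzl; rewrite t00 scale0r addr0 => ->; rewrite eqxx.
  case/negP: uNl'; apply/sub_rVP; exists (- t^-1).
  move/eqP: l'0; rewrite addr_eq0 => /eqP->.
  by rewrite scalerN scaleNr opprK scalerA mulVf // scale1r.
- by rewrite mulmxDl lM -scalemxAl uM scaler0 addr0.
Qed.

Lemma dot_closer (R : realFieldType) N (p v : 'rV[R]_N) : dot p v < dot p p ->
  exists2 t, 0 <= t <= 1 & dot (p + t *: (v - p)) (p + t *: (v - p)) < dot p p.
Proof.
move=> pv; have q0 := dot_ge0 (v - p).
have a0 : dot p (v - p) < 0 by rewrite dotDr dotNr subr_lt0.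
move: (v - p) q0 a0 => q q0 a0; pose a := - dot p q; pose b := dot q q.
have a_gt0 : 0 < a by rewrite oppr_gt0.
have ab : 0 < a + b by rewrite ltr_wpDr.
(* The optimal step a / b may exceed 1; this one stays in [0, 1] and still gains a^2 (2a + b) / (a +
   b)^2. *)
exists (a / (a + b)).
  by rewrite divr_ge0 ?ler_pdivrMr ?mul1r ?lerDl // ltW.
rewrite !(dotDl, dotDr, dotZl, dotZr) (dotC q p) -/b.
rewrite -[dot p q]opprK -/a -subr_gt0.
have -> : dot p p - (dot p p + a / (a + b) * - a +
    (a / (a + b) * - a + a / (a + b) * (a / (a + b) * b)))
    = a ^+ 2 * (2 * a + b) / (a + b) ^+ 2 by field; rewrite gt_eqF.
by rewrite divr_gt0 ?exprn_gt0 // mulr_gt0 ?exprn_gt0 // ltr_wpDr // mulr_gt0.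
Qed.

Lemma simplex_min_vertex (R : realFieldType) m N (W : 'M[R]_(m, N)) (l : 'rV_m) :
  simplex setT l ->
  (forall q, simplex setT q -> dot (l *m W) (l *m W) <= dot (q *m W) (q *m W)) ->
  forall i, dot (l *m W) (l *m W) <= dot (l *m W) (row i W).
Proof.
move=> [l0 _ l1] lmin i; rewrite leNgt; apply/negP => /dot_closer[t /andP[t0 t1]].
apply/negP; rewrite -leNgt.
have -> : l *m W + t *: (row i W - l *m W) = (l + t *: (delta_mx 0 i - l)) *m W.
  by rewrite mulmxDl -scalemxAl mulmxBl -rowE.
apply: lmin; split=> [j|j|]; first 1 last.
- by rewrite inE.
- under eq_bigr do rewrite !mxE eqxx /=.
  rewrite big_split -mulr_sumr sumrB /= l1 (bigD1 i) //= eqxx big1 => [|j /negPf -> //].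
  by rewrite addr0 subrr mulr0 addr0.
rewrite !mxE eqxx /= mulrBr addrCA -[X in _ + (X - _)]mul1r -mulrBl.
by rewrite addr_ge0 // mulr_ge0 ?subr_ge0.
Qed.

(** Barany's exchange argument: take the selection whose hull comes closest to the origin, with
    nearest point p. If p <> 0, then p can be written with a zero weight, and exchanging that vertex
    for a vector of its class with non-positive product with p gives a hull that contains p but
    comes closer to the origin. *)
Lemma colorful_caratheodory (R : realFieldType) N (C : finType)
    (V : 'I_N.+1 -> C -> 'rV[R]_N) (w : 'I_N.+1 -> C -> R) :
  (forall i c, 0 <= w i c) -> (forall i, \sum_c w i c = 1) ->
  (forall i, \sum_c w i c *: V i c = 0) ->
  exists (c : {ffun 'I_N.+1 -> C}) (l : 'rV[R]_N.+1),
    simplex setT l /\ l *m (\matrix_i V i (c i)) = 0.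
Proof.
move=> w0 w1 wV.
have [j0 _|C0] := pickP (@predT C); last first.
  by have /eqP := w1 ord0; rewrite big_pred0 // eq_sym oner_eq0.
pose W (c : {ffun 'I_N.+1 -> C}) := \matrix_i V i (c i).
have [g gP] := fin_all_exists (fun c => simplex_min (W c)).
pose f c := dot (g c *m W c) (g c *m W c).
case: (@arg_minP _ _ _ [ffun=> j0] predT f isT) => c _ cmin.
exists c, (g c); have [gc gmin] := gP c; split=> //; apply/eqP/contraT.
change (_ = _) with (g c *m W c = 0).
set p := g c *m W c => nzp; have p_gt0 : 0 < dot p p by rewrite dot_gt0.
(* By the choice of [c], p is nearest to the origin in every hull containing it, so no vertex of
   that hull lies before the hyperplane through p orthogonal to p. *)
have vertex c' l : simplex setT l -> l *m W c' = p ->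
    forall i, dot p p <= dot p (V i (c' i)).
  move=> Dl lp i; have := @simplex_min_vertex _ _ _ (W c') l Dl _ i.
  rewrite rowK lp; apply=> q Dq; apply: le_trans (proj2 (gP c') q Dq).
  exact: cmin.
have pV l c' : dot p (l *m W c') = \sum_i l 0 i * dot p (V i (c' i)).
  by rewrite mulmx_sum_row dot_sumr; apply: eq_bigr => i _; rewrite rowK dotZr.
have [l [Dl lp [i0 li0]]] : exists l, [/\ simplex setT l, l *m W c = p
    & exists i, l 0 i = 0].
  have [/existsP[i /eqP gi]|/existsPn gn0] := boolP [exists i, g c 0 i == 0].
    by exists (g c); split=> //; exists i.
  have [gc0 _ gc1] := gc.
  (* With all weights positive, every chosen vector lies on that hyperplane. The N + 1 vectors have
     a linear relation; pairing it with p shows that its coefficients sum to 0, so the weights can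
     slide along it until one vanishes. *)
  have eq_p i : dot p (V i (c i)) = dot p p.
    have : \sum_i g c 0 i * (dot p (V i (c i)) - dot p p) = 0.
      under eq_bigr do rewrite mulrBr.
      by rewrite sumrB -pV -mulr_suml gc1 mul1r subrr.
    move/eqP; rewrite psumr_eq0 => [|k _]; last first.
      by rewrite mulr_ge0 // subr_ge0 (vertex c (g c)).
    move=> /allP/(_ i (mem_index_enum _))/=; rewrite mulf_eq0 (negPf (gn0 i)) /=.
    by rewrite subr_eq0 => /eqP.
  have /rowV0Pn[u /sub_kermxP uW nzu] : kermx (W c) != 0.
    by rewrite -mxrank_eq0 mxrank_ker subn_eq0 -ltnNge ltnS rank_leq_col.
  have u0 : \sum_i u 0 i = 0.
    have := pV u c; rewrite uW dot0r; under eq_bigr do rewrite eq_p.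
    rewrite -mulr_suml => /esym/eqP; rewrite mulf_eq0 (gt_eqF p_gt0) orbF.
    by move/eqP.
  have neg : exists i, u 0 i < 0.
    apply/existsP; apply: contraNT nzu => /existsPn u_ge0.
    have /allP uz : all (fun i => true ==> (u 0 i == 0)) (index_enum 'I_N.+1).
      by rewrite -psumr_eq0 ?u0 // => i _; rewrite leNgt.
    by apply/eqP/rowP => i; rewrite mxE; apply/eqP/(uz i)/mem_index_enum.
  have [t [t0 gt0 [j uj jt]]] := boundary_step gc0 neg.
  exists (g c + t *: u); split.
  - split=> [i|i|]; rewrite ?inE ?mxE ?mxE //.
    under eq_bigr do rewrite !mxE.
    by rewrite big_split /= -mulr_sumr u0 mulr0 addr0.
  - by rewrite mulmxDl -scalemxAl uW scaler0 addr0.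
  - by exists j; rewrite !mxE.
have [j Vj] : exists j, dot p (V i0 j) <= 0.
  apply/existsP; apply: contraT => /existsPn/= V_gt0.
  have : \sum_c w i0 c * dot p (V i0 c) = 0.
    by under eq_bigr do rewrite -dotZr; rewrite -dot_sumr wV dot0r.
  move/eqP; rewrite psumr_eq0 => [/allP wz|k _]; last first.
    by rewrite mulr_ge0 // ltW // ltNge V_gt0.
  have /eqP := w1 i0; rewrite big1 ?(eq_sym 0) ?oner_eq0 // => k _.
  have := wz k (mem_index_enum _); rewrite /= mulf_eq0 => /orP[/eqP//|/eqP Vk].
  by have := V_gt0 k; rewrite Vk lexx.
pose c' := [ffun i => if i == i0 then j else c i].
have := vertex c' l Dl _ i0; rewrite ffunE eqxx leNgt (le_lt_trans Vj p_gt0).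
apply; rewrite -lp !mulmx_sum_row; apply: eq_bigr => i _; rewrite !rowK ffunE.
by case: eqP => [->|//]; rewrite li0 !scale0r.
Qed.

(** * General position *)

(** [msize p] exceeds every exponent occurring in p, so the sum over bounded exponent functions
    covers the whole support of p. *)
Lemma mmap_alg_indep (R : numFieldType) (I : finType) (x : I -> R) (p : {mpoly rat[#|I|]}) :
  alg_indep_Q x -> p != 0 -> mmap (@ratr R) (fun i => x (enum_val i)) p != 0.
Proof.
move=> xP nzp; pose D := msize p.
pose mon (e : {ffun I -> 'I_D}) : 'X_{1..#|I|} := [multinom nat_of_ord (e (enum_val i)) | i < #|I|].
have mon_inj : injective mon.
  move=> e e' /mnmP ee; apply/ffunP => i; apply/val_inj.
  by have := ee (enum_rank i); rewrite !mnmE enum_rankK.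
have mon_onto m : m \in msupp p -> exists e, mon e = m.
  move=> mp; have mD i : (m i < D)%N.
    by apply: leq_ltn_trans (msize_mdeg_lt mp); rewrite mdegE (bigD1 i) //= leq_addr.
  exists [ffun i => Ordinal (mD (enum_rank i))]; apply/mnmP => i.
  by rewrite mnmE ffunE /= enum_valK.
have nzq : [ffun e => p@_(mon e)] != 0.
  have [e eE] := mon_onto _ (mlead_supp nzp).
  by apply: contra_neq nzp => /ffunP/(_ e)/eqP; rewrite !ffunE eE mleadc_eq0 => /eqP.
have := xP D _ nzq; congr (_ != 0); rewrite /mmap.
under eq_bigr => e do [rewrite ffunE;
  have -> : \prod_i x i ^+ e i = mmap1 (fun i => x (enum_val i)) (mon e)
   by rewrite /mmap1 (reindex_onto enum_val enum_rank) /=; [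
     apply: eq_big => i; rewrite ?enum_valK ?eqxx // mnmE
   | by move=> i _; rewrite enum_rankK]].
pose F m := ratr p@_m * mmap1 (fun i => x (enum_val i)) m : R.
rewrite -[LHS](big_map mon xpredT F) (bigID (mem (msupp p))) /= [X in _ + X]big1 ?addr0.
  rewrite -big_filter; apply/perm_big/uniq_perm.
  - by rewrite filter_uniq // map_inj_uniq // index_enum_uniq.
  - exact: msupp_uniq.
  move=> m; rewrite mem_filter; case: (boolP (m \in msupp p)) => //= mp.
  by have [e <-] := mon_onto m mp; rewrite map_f ?mem_index_enum.
by move=> m mp; rewrite /F memN_msupp_eq0 // rmorph0 mul0r.
Qed.

Lemma card_inj_in (T1 T2 : finType) (A : {set T1}) (B : {set T2}) (y0 : T2) :
  (#|A| <= #|B|)%N ->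
  exists f : T1 -> T2, {in A, forall x, f x \in B} /\ {in A &, injective f}.
Proof.
move=> leAB; exists (fun x => nth y0 (enum B) (index x (enum A))).
have szx x : x \in A -> (index x (enum A) < size (enum B))%N.
  by move=> xA; rewrite -cardE (leq_trans _ leAB) // cardE index_mem mem_enum.
split=> [x xA|x y xA yA /eqP]; first by rewrite -mem_enum mem_nth ?szx.
rewrite nth_uniq ?enum_uniq ?szx // => /eqP eq_xy.
by rewrite -(nth_index x (_ : x \in enum A)) ?mem_enum // eq_xy nth_index ?mem_enum.
Qed.

Lemma card_ord_lt D k : (k <= D)%N -> #|[set s : 'I_D | (s < k)%N]| = k.
Proof.
move=> kD; rewrite -sum1_card; under eq_bigl do rewrite inE.
by rewrite -(big_ord_widen D (fun=> 1%N)) // sum_nat_const card_ord muln1.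
Qed.

(** Class j can spare D + 1 - b_j labels. These spare slots number at least D + 1 in all, so each
    label s gets a class [m s] that gives it up, and class j keeps at least b_j labels. *)
Lemma class_injective_labelling (I C : finType) (c : I -> C) (S : {set I}) (D : nat) :
  (forall j, #|[set i in S | c i == j]| <= D.+1)%N ->
  (#|S| + D.+1 <= #|C| * D.+1)%N ->
  exists tau : I -> 'I_D.+1,
    {in S &, forall i i', c i = c i' -> tau i = tau i' -> i = i'} /\
    (forall s, exists j, {in S, forall i, c i = j -> tau i != s}).
Proof.
move=> leD leS; pose b j := #|[set i in S | c i == j]|.
have sum_b : (\sum_j b j = #|S|)%N.
  rewrite -[RHS]sum1_card (partition_big c xpredT) //=; apply: eq_bigr => j _.
  by rewrite /b -sum1_card; apply: eq_bigl => i; rewrite inE.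
pose B := [set u : C * 'I_D.+1 | (u.2 < D.+1 - b u.1)%N].
have leB : (#|[set: 'I_D.+1]| <= #|B|)%N.
  rewrite cardsT card_ord -(leq_add2l #|S|); apply: leq_trans leS _.
  rewrite -sum_b -[#|B|]sum1_card.
  under [X in (_ <= _ + X)%N]eq_bigl do rewrite inE.
  rewrite -(pair_big_dep xpredT (fun j (s : 'I_D.+1) => s < D.+1 - b j)%N (fun _ _ => 1%N)) /=.
  rewrite -big_split /= -sum_nat_const leq_sum // => j _.
  rewrite sum1dep_card (card_ord_lt (leq_subr _ _)) addnC subnK //; exact: leD.
have [j0 _|C0] := pickP (@predT C); last by rewrite (eq_card0 C0) in leS; lia.
have [f [fB f_inj]] := card_inj_in (j0, ord0) leB.
pose m s := (f s).1.
have le_m j : (#|[set s | m s == j]| <= D.+1 - b j)%N.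
  rewrite -(card_ord_lt (leq_subr (b j) D.+1)) -(@card_in_imset _ _ (fun s => (f s).2)).
    apply/subset_leq_card/subsetP => t /imsetP[s]; rewrite inE => /eqP ms ->.
    by have := fB s; rewrite !inE -/(m s) ms => ->.
  move=> s s'; rewrite !inE => /eqP ms /eqP ms' eq2; apply: f_inj; rewrite ?inE //.
  by apply/eqP; rewrite -pair_eqE /pair_eq eq2 -!/(m _) ms ms' !eqxx.
have labels j : exists g : I -> 'I_D.+1,
    {in [set i in S | c i == j], forall x, g x \in [set s | m s != j]} /\
    {in [set i in S | c i == j] &, injective g}.
  apply: (card_inj_in ord0); have := le_m j.
  have -> : [set s | m s != j] = ~: [set s | m s == j] by apply/setP=> s; rewrite !inE.
  have := cardsC [set s | m s == j]; rewrite card_ord -/(b j).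
  have : (b j <= D.+1)%N := leD j.
  by move: (b j) #|~: _| #|[set s | m s == j]| => x y z; lia.
have [g gP] := fin_all_exists labels.
exists (fun i => g (c i) i); split=> [i i' iS i'S cc|s].
  by rewrite cc; apply: (proj2 (gP (c i'))); rewrite inE ?iS ?i'S ?cc eqxx.
exists (m s) => i iS ci; have := proj1 (gP (c i)) i; rewrite !inE iS eqxx => /(_ isT).
by rewrite ci; apply: contraNneq => ->.
Qed.

(** * Sarkaria's tensors *)

Section Tensor.
Variables (n d r : nat).
Implicit Types c : 'I_n -> option 'I_r.

(* Sarkaria's vectors: w_j is the j-th unit vector for [j = Some t] and minus the
   sum of all of them for [j = None], so the only linear relation between the r + 1
   vectors w_j is that their sum vanishes. *)
Definition colour_vec (K : pzRingType) (j : option 'I_r) (t : 'I_r) : K :=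
  (j == Some t)%:R - (j == None)%:R.

Definition tensor (K : pzRingType) (u : 'rV[K]_d) (j : option 'I_r) : 'rV[K]_(r * d) :=
  mxvec (\matrix_(t, s) (colour_vec K j t * u 0 s)).

Definition tensor_mx (K : pzRingType) (u : 'I_n -> 'rV[K]_d) c : 'M[K]_(n, r * d) :=
  \matrix_i tensor (u i) (c i).

(** Block t of the combination is the sum over colour [Some t] minus the sum over colour [None]. *)
Lemma tensor_mx_kernel (K : comPzRingType) (u : 'I_n -> 'rV[K]_d) c (l : 'rV_n) :
  l *m tensor_mx u c = 0 <->
  forall j, \sum_(i | c i == j) l 0 i *: u i = \sum_(i | c i == None) l 0 i *: u i.
Proof.
have -> : l *m tensor_mx u c = mxvec (\matrix_(t, s)
    ((\sum_(i | c i == Some t) l 0 i *: u i) 0 s - (\sum_(i | c i == None) l 0 i *: u i) 0 s)).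
  rewrite mulmx_sum_row; under eq_bigr do rewrite rowK -linearZ.
  rewrite -linear_sum; congr mxvec; apply/matrixP => t s.
  rewrite summxE !mxE !summxE !(big_mkcond (fun i => c i == _)) -sumrB.
  apply: eq_bigr => i _; rewrite !mxE /colour_vec mulrBl mulrBr.
  by do 2![case: eqP => _]; rewrite ?mul1r ?mul0r ?mulr0.
split=> [/(canRL mxvecK)|h].
  rewrite linear0 => /matrixP h [t|//]; apply/rowP => s; apply/eqP.
  by rewrite -subr_eq0; have := h t s; rewrite !mxE => /eqP.
apply/eqP; rewrite mxvec_eq0; apply/eqP/matrixP => t s.
by rewrite !mxE h subrr.
Qed.

Lemma map_tensor_mx (K L : pzRingType) (f : {rmorphism K -> L}) (u : 'I_n -> 'rV[K]_d) c :
  map_mx f (tensor_mx u c) = tensor_mx (fun i => map_mx f (u i)) c.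
Proof.
apply/row_matrixP => i; rewrite -map_row !rowK /tensor map_mxvec; congr mxvec.
by apply/matrixP => t s; rewrite !mxE rmorphM rmorphB !rmorph_nat.
Qed.

End Tensor.

Definition affine_lift (K : pzRingType) d (x : 'rV[K]_d) : 'rV[K]_d.+1 :=
  \row_s oapp (x 0) 1 (unlift ord0 s).

Lemma affine_lift0 (K : pzRingType) d (x : 'rV[K]_d) : affine_lift x 0 ord0 = 1.
Proof. by rewrite mxE unlift_none. Qed.

Lemma affine_liftS (K : pzRingType) d (x : 'rV[K]_d) t : affine_lift x 0 (lift ord0 t) = x 0 t.
Proof. by rewrite mxE liftK. Qed.

Lemma map_affine_lift (K L : pzRingType) (f : {rmorphism K -> L}) d (x : 'rV[K]_d) :
  map_mx f (affine_lift x) = affine_lift (map_mx f x).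
Proof.
by apply/rowP => s; rewrite !mxE; case: unliftP => [t|] _ /=; rewrite ?mxE ?rmorph1.
Qed.

(** Independence of the rows becomes non-vanishing of a single polynomial in the entries, which can
    be transferred between configurations. *)
Lemma gram_det_neq0 (R : realFieldType) m N (A : 'M[R]_(m, N)) :
  \det (A *m A^T) != 0 <-> forall l : 'rV_m, l *m A = 0 -> l = 0.
Proof.
rewrite -unitfE -[_ \is a _]unitmxE -row_free_unit /row_free mxrank_gram.
rewrite -/(row_free A) -kermx_eq0; split=> [/eqP K0 l lA|h].
  by apply/eqP; rewrite -submx0 -K0; apply/sub_kermxP.
by apply/rowV0P => l /sub_kermxP/h.
Qed.

(** * Generic independence of the tensors *)

Section Genericity.
Variables (n d r : nat).
Implicit Types (c : 'I_n -> option 'I_r) (S : {set 'I_n}).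

(* The extra diagonal block turns independence of the rows in S into
   independence of all the rows. *)
Definition restricted_tensor_mx (K : pzRingType) (u : 'I_n -> 'rV[K]_d) c S :
    'M[K]_(n, r * d + n) :=
  row_mx (tensor_mx u c) (diag_mx (\row_i (i \notin S)%:R)).

Lemma restricted_tensor_kernel (K : pzRingType) (u : 'I_n -> 'rV[K]_d) c S (l : 'rV_n) :
  l *m restricted_tensor_mx u c S = 0 <->
  l *m tensor_mx u c = 0 /\ forall i, i \notin S -> l 0 i = 0.
Proof.
rewrite mul_mx_row -row_mx0; split=> [/eq_row_mx[lT /rowP lD]|[-> lS]].
  by split=> // i iS; have := lD i; rewrite mul_mx_diag !mxE iS mulr1.
congr row_mx; apply/rowP => i; rewrite mul_mx_diag !mxE.
by case: (boolP (i \in S)) => [_|/lS ->]; rewrite ?mulr0 ?mul0r.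
Qed.

Lemma map_restricted_tensor_mx (K L : pzRingType) (f : {rmorphism K -> L})
    (u : 'I_n -> 'rV[K]_d) c S :
  map_mx f (restricted_tensor_mx u c S) = restricted_tensor_mx (fun i => map_mx f (u i)) c S.
Proof.
rewrite map_row_mx map_tensor_mx map_diag_mx; congr (row_mx _ (diag_mx _)).
by apply/rowP => i; rewrite !mxE rmorph_nat.
Qed.

End Genericity.

(* Placing the points of each colour on vertices of a single simplex, with no vertex
   used by all colours, gives a rational configuration that is in general position. *)
Lemma simplex_config_free (n d r : nat) (c : 'I_n -> option 'I_r) (S : {set 'I_n}) :
  (forall j, #|[set i in S | c i == j]| <= d.+1)%N -> (#|S| <= r * d.+1)%N ->
  exists y : 'I_n -> 'rV[rat]_d, forall l : 'rV_n,
    l *m restricted_tensor_mx (fun i => affine_lift (y i)) c S = 0 -> l = 0.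
Proof.
move=> leD leS; have [|tau [tau_inj tau_miss]] := @class_injective_labelling _ _ c S d leD.
  by rewrite card_option card_ord mulSn addnC leq_add2l.
(* Label 0 stands for the origin, the other labels for the unit vectors. *)
exists (fun i => \row_t (tau i == lift ord0 t)%:R) => l.
move=> /restricted_tensor_kernel[/tensor_mx_kernel lT lS].
(* The vertices are affinely independent, so equal colour sums give each vertex the same total
   weight in all colours; a colour missing the vertex makes this weight 0. *)
pose sigma j s := \sum_(i | (c i == j) && (tau i == s)) l 0 i.
have sigmaS j t : sigma j (lift ord0 t) = sigma None (lift ord0 t).
  have /rowP/(_ (lift ord0 t)) := lT j; rewrite !summxE /sigma.
  rewrite !big_mkcondr /=; congr (_ = _); apply: eq_bigr => i _;
    by rewrite mxE affine_liftS mxE; case: eqP; rewrite ?mulr1 ?mulr0.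
have sum_sigma j : \sum_(i | c i == j) l 0 i = sigma j ord0 + \sum_t sigma j (lift ord0 t).
  by rewrite (partition_big tau xpredT) // big_ord_recl.
have sigma_eq j s : sigma j s = sigma None s.
  have [t ->|->] := unliftP ord0 s; first exact: sigmaS.
  have := sum_sigma None; have := sum_sigma j.
  have -> : \sum_(i | c i == j) l 0 i = \sum_(i | c i == None) l 0 i.
    have /rowP/(_ ord0) := lT j; rewrite !summxE; congr (_ = _); apply: eq_bigr => i _;
      by rewrite mxE affine_lift0 mulr1.
  by move=> ->; under eq_bigr do rewrite sigmaS; move/addIr.
have sigma0 j s : sigma j s = 0.
  have [j' miss] := tau_miss s; rewrite sigma_eq -(sigma_eq j').
  apply: big1 => i /andP[/eqP ci /eqP ti]; apply: lS; apply/negP => iS.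
  by have := miss i iS ci; rewrite ti eqxx.
apply/rowP => i; rewrite mxE; case: (boolP (i \in S)) => iS; last exact: lS.
rewrite -(sigma0 (c i) (tau i)) /sigma (bigD1 i) ?eqxx //= big1 ?addr0 // => i'.
move=> /andP[/andP[/eqP ci /eqP ti] ni]; apply: lS; apply: contra ni => i'S.
by apply/eqP/tau_inj.
Qed.

(** The Gram determinant is a rational polynomial [P] in the coordinates. It is non-zero because its
    value at the simplex configuration is, so algebraic independence keeps it non-zero at [a]. *)
Lemma alg_indep_tensor_free (R : realFieldType) (n d r : nat) (a : 'I_n -> 'rV[R]_d)
    (c : 'I_n -> option 'I_r) (S : {set 'I_n}) (l : 'rV[R]_n) :
  alg_indep_Q (fun ij : 'I_n * 'I_d => a ij.1 0 ij.2) ->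
  (forall j, #|[set i in S | c i == j]| <= d.+1)%N -> (#|S| <= r * d.+1)%N ->
  l *m tensor_mx (fun i => affine_lift (a i)) c = 0 ->
  (forall i, i \notin S -> l 0 i = 0) -> l = 0.
Proof.
move=> a_indep leD leS lT lS; have [y yfree] := simplex_config_free leD leS.
pose A (K : nzRingType) (x : 'I_n -> 'rV[K]_d) :=
  restricted_tensor_mx (fun i => affine_lift (x i)) c S.
pose I : finType := ('I_n * 'I_d)%type.
pose X i : 'rV[{mpoly rat[#|I|]}]_d := \row_t 'X_(enum_rank ((i, t) : I)).
pose P := \det (A _ X *m (A _ X)^T).
have evalP (K : comNzRingType) (f : {rmorphism rat -> K}) (x : 'I_n -> 'rV[K]_d) :
    mmap f (fun k => x (enum_val k).1 0 (enum_val k).2) P = \det (A _ x *m (A _ x)^T).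
  have AX : map_mx (mmap f (fun k => x (enum_val k).1 0 (enum_val k).2)) (A _ X) = A _ x.
    rewrite map_restricted_tensor_mx; congr row_mx; apply/row_matrixP => i.
    rewrite !rowK map_affine_lift; congr (tensor (affine_lift _) _); apply/rowP => t.
    by rewrite !mxE /= mmapX mmap1U enum_rankK.
  by rewrite -det_map_mx map_mxM -matrix.map_trmx AX.
apply: (proj1 (gram_det_neq0 (A _ a))); last exact/restricted_tensor_kernel.
rewrite -(evalP R (@ratr R)); apply: (mmap_alg_indep a_indep).
apply: contraTneq (proj2 (gram_det_neq0 (A _ y)) yfree) => P0.
by rewrite -(evalP rat idfun) P0 rmorph0 eqxx.
Qed.

Lemma alg_indep_inj (R : numFieldType) (I : finType) (x : I -> R) :
  alg_indep_Q x -> injective x.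
Proof.
move=> xP i j eq_x; apply/eqP/contraT => nij.
pose p : {mpoly rat[#|I|]} := 'X_(enum_rank i) - 'X_(enum_rank j).
have nzp : p != 0.
  suff : p.@[fun k => (k == enum_rank i)%:R] != 0.
    by apply: contraNneq => ->; rewrite meval0.
  rewrite mevalB !mevalXU eqxx (inj_eq enum_rank_inj) [j == i]eq_sym (negPf nij).
  by rewrite subr0 oner_eq0.
have := mmap_alg_indep xP nzp.
by rewrite rmorphB /= !mmapX !mmap1U !enum_rankK eq_x subrr eqxx.
Qed.

(** * Signs *)

Lemma sublevel_card (R : realDomainType) (I : finType) (x : I -> R) k :
  injective x -> (k <= #|I|)%N -> exists th, #|[set i | x i <= th]| = k.
Proof.
move=> x_inj; elim: k => [_|k IHk ltk].
  have [i0 _|I0] := pickP (@predT I); last first.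
    by exists 0; apply/eqP; rewrite cards_eq0; apply/eqP/setP => i; have := I0 i.
  case: (@arg_minP _ _ _ i0 predT x isT) => i _ imin; exists (x i - 1).
  apply/eqP; rewrite cards_eq0; apply/eqP/setP => j; rewrite !inE leNgt.
  by apply/negbTE; rewrite negbK (lt_le_trans _ (imin j isT)) // ltrBlDr ltrDl.
have [th thk] := IHk (ltnW ltk).
have [i0 i0th] : exists i, th < x i.
  apply/existsP; apply: contraLR ltk => /existsPn h; rewrite -leqNgt -thk.
  by apply/subset_leq_card/subsetP => i _; rewrite inE leNgt h.
case: (@arg_minP _ _ _ i0 (fun i => th < x i) x i0th) => i ith imin.
exists (x i); rewrite -thk.
have -> : [set j | x j <= x i] = i |: [set j | x j <= th].
  apply/setP => j; rewrite !inE; apply/idP/orP => [xji|[/eqP->//|xj]].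
    have [xj|/imin xij] := leP (x j) th; [by right|left].
    by apply/eqP/x_inj/le_anti; rewrite xji.
  exact: le_trans xj (ltW ith).
by rewrite cardsU1 inE leNgt ith.
Qed.

Lemma dependent_subset (K : fieldType) m N (X : 'M[K]_(m, N)) (T : {set 'I_m}) :
  (N < #|T|)%N ->
  exists u : 'rV_m, [/\ u != 0, u *m X = 0 & forall i, i \notin T -> u 0 i = 0].
Proof.
move=> ltNT; pose F : 'M[K]_(#|T|, m) := rowsub enum_val 1%:M.
have /rowV0Pn[q /sub_kermxP qFX nzq] : kermx (F *m X) != 0.
  by rewrite -mxrank_eq0 mxrank_ker subn_eq0 -ltnNge (leq_ltn_trans (rank_leq_col _)).
have qF i : (q *m F) 0 i = \sum_(k | enum_val k == i) q 0 k.
  rewrite mxE [RHS]big_mkcond; apply: eq_bigr => k _; rewrite !mxE.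
  by case: eqP; rewrite ?mulr1 ?mulr0.
exists (q *m F); split; rewrite -?mulmxA //.
- apply: contra_neq nzq => qF0; apply/rowP => k.
  have /rowP/(_ (enum_val k)) := qF0; rewrite qF (bigD1 k) //= big1 ?addr0 ?mxE //.
  by move=> k' /andP[/eqP/enum_val_inj->]; rewrite eqxx.
- move=> i iT; rewrite qF big1 // => k /eqP ki.
  by rewrite -ki enum_valP in iT.
Qed.

Lemma sum_tensor (K : comPzRingType) d r (u : 'rV[K]_d) :
  \sum_(j : option 'I_r) tensor u j = 0.
Proof.
rewrite -linear_sum; apply/eqP; rewrite mxvec_eq0; apply/eqP/matrixP => t s.
rewrite summxE; under eq_bigr do rewrite mxE; rewrite -mulr_suml mxE sumrB.
have one (j0 : option 'I_r) : \sum_j (j == j0)%:R = 1 :> K.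
  by rewrite (bigD1 j0) //= eqxx big1 ?addr0 // => j /negPf ->.
by rewrite !one subrr mul0r.
Qed.

Section Signs.
Variables (R : realFieldType) (I : finType) (x : I -> R) (th : R).

Definition lower_sign i : R := (-1) ^+ (x i <= th)%R.

Lemma lower_signK i : lower_sign i * lower_sign i = 1.
Proof. by rewrite /lower_sign -expr2 sqrr_sign. Qed.

(** Pairing with x - th turns each term into l_i |x_i - th|, so l vanishes above th; the remaining
    signs are all -1 and the first relation finishes. *)
Lemma lower_sign_dependence (l : I -> R) : (forall i, 0 <= l i) ->
  \sum_i l i * lower_sign i = 0 -> \sum_i l i * lower_sign i * x i = 0 ->
  forall i, l i = 0.
Proof.
move=> l0 sum0 sumx.
have term_ge0 i : 0 <= l i * (lower_sign i * (x i - th)).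
  rewrite mulr_ge0 // /lower_sign; case: (leP (x i) th) => xi /=.
    by rewrite expr1 mulN1r oppr_ge0 subr_le0.
  by rewrite mul1r subr_ge0 ltW.
have /eqP : \sum_i l i * (lower_sign i * (x i - th)) = 0.
  under eq_bigr do rewrite !mulrBr !mulrA.
  by rewrite sumrB -mulr_suml sum0 mul0r sumx subrr.
rewrite psumr_eq0 // => /allP term0.
have l_upper i : th < x i -> l i = 0.
  move=> xi; have := term0 i (mem_index_enum _).
  rewrite /= /lower_sign leNgt xi /= mul1r mulf_eq0 subr_eq0 (gt_eqF xi) orbF.
  by move/eqP.
have /eqP : \sum_i l i = 0.
  apply: oppr_inj; rewrite oppr0 -sumrN -[RHS]sum0; apply: eq_bigr => i _.
  by rewrite /lower_sign; case: (leP (x i) th) => [_|/l_upper->] /=; rewrite ?oppr0 ?mul0r ?mulrN1.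
rewrite psumr_eq0 // => /allP lz i; apply/eqP.
exact: (lz i (mem_index_enum _)).
Qed.

End Signs.

(** There are r + 1 colours, and the number of points exceeds the dimension r(d + 1) of the tensors
    by one, as colorful Caratheodory requires. That the kernel is a line later yields uniqueness. *)
Lemma signed_sarkaria (R : realFieldType) (r d : nat)
    (a : 'I_(r * d.+1).+1 -> 'rV[R]_d) (t0 : 'I_d) (th : R) :
  (0 < r)%N -> alg_indep_Q (fun ij : 'I_(r * d.+1).+1 * 'I_d => a ij.1 0 ij.2) ->
  let sg (i : 'I_(r * d.+1).+1) := lower_sign (fun i => a i 0 t0) th i in
  let M c := tensor_mx (fun i => sg i *: affine_lift (a i)) c in
  exists (c : 'I_(r * d.+1).+1 -> option 'I_r) (l : 'rV[R]_(r * d.+1).+1),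
  [/\ forall i, 0 < l 0 i, l *m M c = 0,
      forall u : 'rV_(r * d.+1).+1, u *m M c = 0 -> exists b, u = b *: l,
      forall j, (#|[set i | c i == j]| <= d.+1)%N
    & forall j, exists i, c i = j].
Proof.
move=> r0 a_indep sg M; pose C : finType := option 'I_r.
pose u (i : 'I_(r * d.+1).+1) : 'rV[R]_d.+1 := sg i *: affine_lift (a i).
have C0 : (#|C|%:R : R) != 0 by rewrite pnatr_eq0 card_option.
(* The r + 1 tensors of a point sum to 0, so uniform weights put the origin in the hull of its
   class. *)
have [|||c [l [Dl lM]]] := @colorful_caratheodory R (r * d.+1) C
    (fun i => tensor (u i)) (fun _ _ => #|C|%:R^-1).
- by move=> _ _; rewrite invr_ge0 ler0n.
- by move=> _; rewrite sumr_const -[_^-1 *+ _]mulr_natr mulVf.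
- by move=> i; rewrite -scaler_sumr sum_tensor scaler0.
have nzl : l != 0.
  by apply/eqP => l0; have [_ _ /eqP] := Dl; rewrite l0 big1 ?(eq_sym 0) ?oner_eq0 // => i _; rewrite mxE.
have [l0 _ _] := Dl.
have {lM nzl l0 Dl l} [l [l0 nzl lM l_min]] := minimal_kernel_vector l0 nzl lM.
have kerM (q : 'rV_(r * d.+1).+1) := tensor_mx_kernel u c q.
have /kerM lc := lM; set v := \sum_(i | c i == None) _ in lc.
(* If v = 0, the whole signed sum is 0, and its coordinates [ord0] and [lift ord0 t0] are the two
   relations of [lower_sign_dependence]. *)
have nzv : v != 0.
  apply: contra_neq nzl => v0; apply/rowP => i; rewrite mxE; move: i.
  have sum0 : \sum_i l 0 i *: u i = 0.
    rewrite (partition_big c xpredT) //= big1 // => j _.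
    by rewrite lc.
  apply: (lower_sign_dependence (x := fun i => a i 0 t0) (th := th)) => //.
    have /rowP/(_ ord0) := sum0; rewrite summxE [in RHS]mxE => E; rewrite -[RHS]E.
    by apply: eq_bigr => i _; rewrite !mxE unlift_none mulr1.
  have /rowP/(_ (lift ord0 t0)) := sum0; rewrite summxE [in RHS]mxE => E; rewrite -[RHS]E.
  by apply: eq_bigr => i _; rewrite !mxE liftK mulrA.
pose S := [set i | l 0 i != 0].
(* More than d + 1 support points of one colour are dependent. The dependence lies in the kernel, so
   it is a multiple of l by minimality; then l vanishes on the other colours and v = 0. *)
have classS j : (#|[set i in S | c i == j]| <= d.+1)%N.
  rewrite leqNgt; apply: contra nzv => ltT.
  have [q [nzq qu qT]] := dependent_subset (\matrix_i u i) ltT.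
  have q0 j' : \sum_(i | c i == j') q 0 i *: u i = 0.
    have [->|nj] := eqVneq j' j; last first.
      by apply: big1 => i /eqP ci; rewrite qT ?scale0r // !inE ci (negPf nj) andbF.
    rewrite -[RHS]qu mulmx_sum_row [RHS](bigID (fun i => c i == j)) /=.
    rewrite [X in _ = _ + X]big1 ?addr0 => [|i ci].
      by apply: eq_bigr => i _; rewrite rowK.
    by rewrite qT ?scale0r // !inE (negPf ci) andbF.
  have [||b qE] := l_min q.
  - by apply/kerM => j'; rewrite !q0.
  - by move=> i li; apply: qT; rewrite !inE li eqxx.
  have nzb : b != 0 by apply: contra_neq nzq => b0; rewrite qE b0 scale0r.
  have [j' nj] : exists j', j' != j by case: (j) => [t|]; [exists None|exists (Some (Ordinal r0))].
  rewrite -(lc j'); apply/eqP/big1 => i /eqP ci.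
  have /eqP : q 0 i = 0 by apply: qT; rewrite !inE ci (negPf nj) andbF.
  by rewrite qE mxE mulf_eq0 (negPf nzb) /= => /eqP->; rewrite scale0r.
(* A smaller support would contradict general position, once the signs are absorbed into the
   weights. *)
have ST : S = setT.
  apply/eqP; rewrite eqEcard subsetT cardsT card_ord ltnNge /=.
  apply: contra nzl => leS; pose q : 'rV[R]_(r * d.+1).+1 := \row_i (l 0 i * sg i).
  have q0 : q = 0.
    apply: (alg_indep_tensor_free a_indep classS leS).
      apply/tensor_mx_kernel => j; have := lc j; rewrite /v => E.
      by under eq_bigr do rewrite mxE -scalerA; under [RHS]eq_bigr do rewrite mxE -scalerA.
    by move=> i; rewrite inE negbK mxE => /eqP->; rewrite mul0r.
  apply/eqP/rowP => i; have /rowP/(_ i) := q0; rewrite !mxE => /(congr1 ( *%R^~ (sg i))).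
  by rewrite -mulrA lower_signK mulr1 mul0r.
have l_gt0 i : 0 < l 0 i.
  by rewrite lt0r l0 andbT; have := in_setT i; rewrite -ST inE.
exists c, l; split=> //.
- by move=> q qM; apply: l_min => // i li; have := l_gt0 i; rewrite li ltxx.
- move=> j; have := classS j; rewrite ST; congr (_ <= _)%N; apply: eq_card => i.
  by rewrite !inE.
- move=> j; have [/existsP[i /eqP ci]|/existsPn cj] := boolP [exists i, c i == j].
    by exists i.
  case/eqP: nzv.
  by rewrite -(lc j) big_pred0 // => i; apply/negbTE/cj.
Qed.

(** * From the weights to the partition *)

Unset Implicit Arguments.

Theorem mainTheorem1 (R : realFieldType) (r d n : nat)
  (hr : (2 <= r)%N) (hd : (1 <= d)%N) (hn : n = ((r - 1) * (d + 1) + 1)%N)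
  (a : 'I_n -> 'rV[R]_d)
  (ha : alg_indep_Q (fun ij : 'I_n * 'I_d => a ij.1 0 ij.2))
  (k : nat) (hk : (k <= r - 1)%N) :
  exists P : {set {set 'I_n}}, proper_partition d r P /\
    exists (z : 'rV[R]_d) (alpha : 'I_n -> R),
      [/\ tverberg_system a P z alpha,
          (forall z' alpha', tverberg_system a P z' alpha' ->
             z' = z /\ forall x, alpha' x = alpha x)
        & #|[set x : 'I_n | alpha x < 0]| = k].
Proof.
(* From here on r is one less than the number of parts, which are indexed by [option 'I_r]. *)
case: r hr hn hk => // r r_gt0; rewrite subSS subn0 !addn1 => hn hk; subst n.
rewrite ltnS in r_gt0; pose t0 := Ordinal hd; pose x (i : 'I_(r * d.+1).+1) : R := a i 0 t0.
have x_inj : injective x by move=> i j /(@alg_indep_inj _ _ _ ha (i, t0) (j, t0)) [].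
have [|th thk] := @sublevel_card _ _ x k x_inj.
  by rewrite card_ord (leq_trans hk) // leqW // leq_pmulr.
have [c [l [l_gt0 lM l_span class_le class_ex]]] := signed_sarkaria t0 th r_gt0 ha.
pose sg (i : 'I_(r * d.+1).+1) : R := lower_sign x th i.
change (tensor_mx _ c) with (tensor_mx (fun i => sg i *: affine_lift (a i)) c) in lM, l_span.
have sgE i : sg i = (-1) ^+ (x i <= th)%R by [].
have sgK i : sg i * sg i = 1 by apply: lower_signK.
clearbody sg.
pose class (j : option 'I_r) : {set 'I_(r * d.+1).+1} := [set i | c i == j].
have class_inj : injective class.
  move=> j j' /setP eq_jj'; have [i ci] := class_ex j.
  by have := eq_jj' i; rewrite !inE ci eqxx => /esym/eqP.
pose P := [set class j | j : option 'I_r].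
have classP j : class j \in P by apply: imset_f.
pose v : 'rV[R]_d.+1 := \sum_(i | c i == None) l 0 i *: (sg i *: affine_lift (a i)).
have lv j : \sum_(i | c i == j) l 0 i *: (sg i *: affine_lift (a i)) = v.
  by move: j; apply/tensor_mx_kernel.
pose s : R := v 0 ord0.
have sum_s j : \sum_(i | c i == j) sg i * l 0 i = s.
  rewrite /s -(lv j) summxE; apply: eq_bigr => i _.
  by rewrite !mxE unlift_none mulr1 mulrC.
have s_gt0 : 0 < s.
  (* The k <= r points below th meet at most k of the r + 1 colours; on a missed colour all signs
     are +1. *)
  have [j cj] : exists j, j \notin c @: [set i | x i <= th].
    apply/existsP; rewrite -negb_forall; apply/negP => /forallP all_j.
    have : (#|{: option 'I_r}| <= #|c @: [set i | (x i <= th)%R]|)%N.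
      by apply/subset_leq_card/subsetP => j _; apply: all_j.
    rewrite card_option card_ord leqNgt ltnS; apply/negP; rewrite negbK.
    by rewrite (leq_trans (leq_imset_card _ _)) // thk.
  have sg1 i : c i == j -> sg i = 1.
    move=> /eqP ci; rewrite sgE; case: leP => // xi; case/negP: cj.
    by rewrite -ci imset_f // inE.
  have [i ci] := class_ex j; rewrite -(sum_s j) (bigD1 i) ?ci //= ltr_pwDl //.
    by rewrite sg1 ?ci // mul1r.
  by apply: sumr_ge0 => i' /andP[/sg1-> _]; rewrite mul1r ltW.
pose alpha i := sg i * l 0 i / s; pose z := \row_t (v 0 (lift ord0 t) / s).
have sum_class (V : nmodType) j (F : _ -> V) :
    \sum_(i in class j) F i = \sum_(i | c i == j) F i.
  by apply: eq_bigl => i; rewrite inE.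
exists P; split.
  apply/and3P; split.
  - have -> : P = preim_partition c setT; last exact: preim_partitionP.
    apply/setP => B; apply/imsetP/imsetP => [[j _ ->]|[i _ ->]].
      have [i ci] := class_ex j; exists i => //; apply/setP => i'.
      by rewrite !inE ci eq_sym.
    by exists (c i) => //; apply/setP => i'; rewrite !inE eq_sym.
  - by rewrite card_imset // card_option card_ord.
  - apply/forall_inP => _ /imsetP[j _ ->]; rewrite class_le andbT.
    by apply/card_gt0P; have [i ci] := class_ex j; exists i; rewrite inE ci.
exists z, alpha; split.
- move=> _ /imsetP[j _ ->]; rewrite !sum_class -mulr_suml sum_s divff ?gt_eqF //.
  split=> //; apply/rowP => t; rewrite mxE -(lv j) !summxE mulr_suml.
  by apply: eq_bigr => i _; rewrite !mxE liftK /alpha mulrA [l 0 i * _]mulrC mulrAC.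
- move=> z' alpha' sys'.
  (* Undoing the signs turns any solution into a kernel vector, hence a multiple of l; the
     normalisation to sum 1 then fixes the factor. *)
  have [b bE] : exists b, \row_i (sg i * alpha' i) = b *: l.
    have sys_lift j : \sum_(i | c i == j)
        (\row_i (sg i * alpha' i)) 0 i *: (sg i *: affine_lift (a i)) = affine_lift z'.
      have [z'E sum1] := sys' _ (classP j).
      rewrite !sum_class in z'E sum1; apply/rowP => q; rewrite summxE !mxE.
      under eq_bigr do rewrite !mxE mulrA [_ * sg _]mulrAC sgK mul1r.
      case: unliftP => [t|] _ /=.
        by rewrite z'E summxE; apply: eq_bigr => i _; rewrite mxE.
      by rewrite -[RHS]sum1; apply: eq_bigr => i _; rewrite mulr1.
    by apply: l_span; apply/tensor_mx_kernel => j; rewrite !sys_lift.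
  have alphaE i : alpha' i = b * s * alpha i.
    have /rowP/(_ i) := bE; rewrite !mxE => /(congr1 ( *%R (sg i))).
    rewrite mulrA sgK mul1r => ->; rewrite /alpha; by field; rewrite gt_eqF.
  have [z'E sum1] := sys' _ (classP None).
  rewrite sum_class in sum1.
  have bs : b * s = 1.
    rewrite -sum1; under eq_bigr do rewrite alphaE.
    by rewrite -mulr_sumr -mulr_suml sum_s divff ?mulr1 ?gt_eqF.
  split=> [|i]; last by rewrite alphaE bs mul1r.
  rewrite z'E; apply/rowP => t; rewrite mxE -(lv None) !summxE mulr_suml sum_class.
  apply: eq_bigr => i _; rewrite !mxE liftK alphaE bs mul1r.
  by rewrite /alpha mulrA [l 0 i * _]mulrC mulrAC.
(* As l_i and s are positive, [alpha] has the sign [sg], negative exactly on the k points below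
   th. *)
- rewrite -thk; apply: eq_card => i; rewrite !inE /alpha sgE.
  case: (leP (x i) th) => xi /=; rewrite ?expr1 ?mulN1r ?mul1r.
    by rewrite mulNr oppr_lt0 divr_gt0.
  by apply/negbTE; rewrite -leNgt divr_ge0 // ltW.
Qed.
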